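(* Let $k,N$ be integers with $2\le k\le N-1$, let $R>0$ and $Q_{2R}=(-R,R)^N$. Let $\mu\in\mathbb{R}$ and assume that $u$ is a solution of $$\begin{cases}\mathcal{P}^+_k(D^2u)+\mu u=0 & \text{in } Q_{2R},\\ u>0 & \text{in } Q_{2R},\\ u=0 & \text{on } \partial Q_{2R}.\end{cases}$$ Then there are no functions $f\in C^2(-R,R)$ such that $u(x)=\prod_{i=1}^N f(x_i)$ for $x\in Q_{2R}$.
   Context: For a symmetric real $N\times N$ matrix $X$ with ordered eigenvalues $\lambda_1(X)\le\dots\le\lambda_N(X)$, $\mathcal{P}^+_k(X)=\sum_{i=1}^k\lambda_{N+1-i}(X)$ is the sum of the $k$ largest eigenvalues. Solutions are continuous on $\overline{Q_{2R}}$ and the equation is understood in the viscosity sense (equivalently in the classical sense when $u$ is $C^2$ in $Q_{2R}$). *)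

(* Defs.v *)
From HB Require Import structures.
From mathcomp Require Import all_boot all_order all_algebra.
From mathcomp Require Import all_classical all_reals all_analysis.
From mathcomp Require complex.

Set Implicit Arguments.
Unset Strict Implicit.
Unset Printing Implicit Defensive.

Import Order.TTheory GRing.Theory Num.Theory.
Import numFieldNormedType.Exports.

Local Open Scope classical_set_scope.
Local Open Scope ring_scope.

Definition is_spectrum (R : realType) (N : nat) (X : 'M[R]_N) (s : seq R) : Prop :=
  sorted <=%R s /\ char_poly X = \prod_(a <- s) ('X - a%:P).

(* Equal to [::] when char_poly X does not split over R; by spectrumP this
   does not happen for symmetric X. *)
Definition spectrum (R : realType) (N : nat) (X : 'M[R]_N) : seq R :=
  xget [::] [set s | is_spectrum X s].

(* The j-th eigenvalue in nondecreasing order, with multiplicity, numbered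
   from j = 1. *)
Definition lambda (R : realType) (N : nat) (X : 'M[R]_N) (j : nat) : R :=
  nth 0 (spectrum X) j.-1.

Definition Pplus (R : realType) (N k : nat) (X : 'M[R]_N) : R :=
  \sum_(1 <= i < k.+1) lambda X (N.+1 - i).

Lemma char_poly_conj (F : comUnitRingType) (n : nat) (P A : 'M[F]_n) :
  P \in unitmx -> char_poly (invmx P *m A *m P) = char_poly A.
Proof.
move=> Pu; rewrite /char_poly /char_poly_mx.
rewrite (_ : _ - _ = map_mx polyC (invmx P) *m ('X%:M - map_mx polyC A)
                     *m map_mx polyC P).
  rewrite !det_mulmx mulrAC -det_mulmx -map_mxM mulVmx //.
  by rewrite map_mx1 det1 mul1r.
rewrite mulmxBr mulmxBl -!map_mxM; congr (_ - _).
by rewrite -mulmxA -scalar_mxC mulmxA -map_mxM mulVmx // map_mx1 mul1mx.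
Qed.

Section SpectrumP.
Import complex.

Lemma spectrumP (R : realType) (N : nat) (X : 'M[R]_N) :
  X^T = X -> is_spectrum X (spectrum X).
Proof.
move=> symX; suff [s sP] : exists s, is_spectrum X s.
  by apply: (xgetPex [::]); exists s.
pose A : 'M[complex.complex R]_N := map_mx (complex.real_complex R) X.
have Ah : A \is hermsymmx.
  apply: realsym_hermsym.
    apply/is_hermitianmxP; rewrite expr0 scale1r; apply/matrixP => i j.
    by rewrite !mxE -[in LHS]symX mxE.
  apply/mxOverP => i j; rewrite mxE; apply/complex_realP.
  by exists (X i j).
have /hermitian_normalmx/orthomx_spectralP Aeq := Ah.
have /mxOverP dR := hermitian_spectral_diag_real Ah.
set d := spectral_diag A in Aeq dR.
pose t := [seq complex.Re (d 0 i) | i <- enum 'I_N].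
exists (sort <=%R t); split; first exact: sort_le_sorted.
rewrite (perm_big _ (permEl (perm_sort _ _))) big_map big_enum /=.
apply: (@map_poly_inj _ _ (complex.real_complex R)).
rewrite map_char_poly -/A Aeq char_poly_conj ?spectral_unit //.
rewrite char_poly_trig ?diag_mx_is_trig // rmorph_prod; apply: eq_bigr => i _.
rewrite rmorphB /= map_polyX map_polyC mxE eqxx mulr1n.
by have /complex_realP[x ->] := dR 0 i.
Qed.

End SpectrumP.

Section DifferentialOperators.
Variables (R : realType) (N : nat).
Implicit Types (f u phi : 'rV[R]_N -> R) (U : set 'rV[R]_N).

Definition basis_vec (i : 'I_N) : 'rV[R]_N := delta_mx 0 i.

Definition hessian f (x : 'rV[R]_N) : 'M[R]_N :=
  \matrix_(i, j) 'D_(basis_vec i) ('D_(basis_vec j) f) x.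

Definition continuous_on U f := forall x, U x -> {for x, continuous f}.

Definition has_partials U f :=
  forall x, U x -> forall i, derivable f x (basis_vec i).

(* Meant for open U. *)
Definition C2_on U f : Prop :=
  [/\ continuous_on U f,
      has_partials U f,
      forall i, continuous_on U ('D_(basis_vec i) f),
      forall i, has_partials U ('D_(basis_vec i) f) &
      forall i j, continuous_on U ('D_(basis_vec i) ('D_(basis_vec j) f))].

Definition local_max f (x : 'rV[R]_N) := \forall y \near x, f y <= f x.
Definition local_min f (x : 'rV[R]_N) := \forall y \near x, f x <= f y.

(* Pplus k is nondecreasing in the matrix argument, which fixes the directions
   of the two inequalities below. *)
Definition viscosity_subsolution (k : nat) (mu : R) U u :=
  forall phi x, C2_on U phi -> U x -> local_max (fun y => u y - phi y) x ->
    0 <= Pplus k (hessian phi x) + mu * u x.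

Definition viscosity_supersolution (k : nat) (mu : R) U u :=
  forall phi x, C2_on U phi -> U x -> local_min (fun y => u y - phi y) x ->
    Pplus k (hessian phi x) + mu * u x <= 0.

Definition viscosity_solution (k : nat) (mu : R) U u :=
  viscosity_subsolution k mu U u /\ viscosity_supersolution k mu U u.

(* The open cube of side length 2r. *)
Definition cube (r : R) : set 'rV[R]_N :=
  [set x | forall i, - r < x 0 i < r].

Definition boundary U : set 'rV[R]_N := closure U `\` interior U.

End DifferentialOperators.

Arguments cube {R} N r _.

Definition C2_itv (R : realType) (a b : R) (f : R -> R) : Prop :=
  forall x : R, a < x < b ->
    [/\ derivable f x 1, derivable (derive1 f) x 1 &
        {for x, continuous (derive1 (derive1 f))}].

(* Main.v *)
(* On the cube [D^2 u = u (diag (a x_i) + p p^T)] with [p = f'/f = (log f)'] and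
   [a = (log f)''].  On the diagonal [x = (t, ..., t)] the equation becomes
   [k a(t) + N p(t)^2 = - mu].  Let [s] be a critical point of [f], and [t] a
   point with [p(t) != 0]; both exist because [f^N] is positive inside and
   vanishes at the endpoints.  At the point with [N - k + 1] coordinates [t] and
   [k - 1] coordinates [s], the eigenvalues of [D^2 u / u] are [a(t)] ([N - k]
   times), [a(s)] ([k - 1] times) and [a(t) + (N - k + 1) p(t)^2], and the
   diagonal equation shows that they are listed in increasing order.  The
   equation there contradicts the diagonal one, the defect being
   [(k - 1) (N - k) p(t)^2 / k > 0]. *)
Require Import Defs.
From mathcomp Require Import all_boot all_order all_algebra.
From mathcomp Require Import all_classical all_reals all_analysis.
From mathcomp Require Import ring lra zify.

Import Order.TTheory GRing.Theory Num.Theory.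
Import numFieldNormedType.Exports.

Local Open Scope classical_set_scope.
Local Open Scope ring_scope.

(** * Spectra of a scalar matrix plus a multiple of the all-ones matrix *)

Lemma det_scalar_sub_const (R : comNzRingType) (n : nat) (x c : R) :
  x * \det (x%:M - c *: const_mx 1 : 'M[R]_n) = x ^+ n * (x - c *+ n).
Proof.
(* Schur complements of the bordered matrix [B]: clearing its lower left block gives the determinant
   sought, and clearing its upper right block gives [x ^+ n * (x - c *+ n)]. The second multiplier
   has determinant [x], whence the extra factor and no division. *)
pose e : 'cV[R]_n := const_mx 1; pose B := block_mx x%:M (c *: e) e^T (1%:M : 'M[R]_1).
have eeT : e *m e^T = const_mx 1.
  by apply/matrixP => i j; rewrite !mxE big_ord1 !mxE mul1r.
have eTe : e^T *m e = (n%:R)%:M.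
  apply/matrixP => i j; rewrite !mxE !ord1 eqxx mulr1n.
  under eq_bigr do rewrite !mxE mul1r.
  by rewrite sumr_const card_ord.
have -> : \det (x%:M - c *: const_mx 1 : 'M[R]_n) = \det B.
  have L1 : \det (block_mx 1%:M 0 (- e^T) (1%:M : 'M[R]_1)) = 1.
    by rewrite det_lblock !det1 mulr1.
  rewrite -[RHS]mulr1 -[X in _ = _ * X]L1 -det_mulmx mulmx_block !mulmx1 !mulmx0 !mul1mx
    !add0r addrN.
  by rewrite det_ublock det1 mulr1 mulmxN -scalemxAl eeT.
have : \det (B *m block_mx 1%:M (- (c *: e)) 0 (x%:M : 'M[R]_1)) = \det B * x.
  by rewrite det_mulmx det_ublock det1 mul1r det_scalar1.
rewrite mulrC => <-.
rewrite mulmx_block !mulmx1 !mulmx0 !mul1mx !addr0 mul_scalar_mx mul_mx_scalar.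
rewrite scalerN addNr mulmxN -scalemxAr eTe det_lblock det_scalar.
congr (_ * _); rewrite det_mx11 !mxE eqxx !mulr1n.
by rewrite mulr_natr addrC.
Qed.

Lemma char_poly_scalar_add_const (F : idomainType) (n : nat) (a c : F) :
  char_poly (a%:M + c *: const_mx 1 : 'M[F]_n.+1) =
  ('X - a%:P) ^+ n * ('X - (a + c *+ n.+1)%:P).
Proof.
have Xa : 'X - a%:P != 0 by rewrite polyXsubC_eq0.
(* The factor ['X - a%:P] needed by the determinant identity can be cancelled in the domain of
   polynomials. *)
apply: (mulfI Xa); rewrite mulrA -exprS.
have -> : 'X - (a + c *+ n.+1)%:P = 'X - a%:P - c%:P *+ n.+1.
  by rewrite polyCD polyCMn opprD addrA.
rewrite -det_scalar_sub_const /char_poly /char_poly_mx; congr (_ * \det _).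
apply/matrixP => i j; rewrite !mxE.
by case: eqP => _; rewrite ?mulr1n ?mulr0n ?sub0r !mulr1 ?add0r // polyCD opprD addrA.
Qed.

Lemma sorted_nseq3 (d : Order.disp_t) (T : orderType d) (m k : nat) (a c b : T) :
  (a <= c)%O -> (c <= b)%O ->
  sorted <=%O (nseq m a ++ nseq k c ++ [:: b]).
Proof.
move=> ac cb; rewrite sorted_pairwise; last exact: le_trans.
have pn n (z : T) : pairwise <=%O (nseq n z).
  by elim: n => //= n ->; rewrite all_nseq lexx orbT.
rewrite !pairwise_cat !pn /= !allrel_catr !andbT.
have alln n n' (y z : T) : (y <= z)%O -> allrel <=%O (nseq n y) (nseq n' z).
  by move=> yz; apply/allrelP => s t /nseqP[-> _] /nseqP[-> _].
by rewrite alln //= (alln m 1%N) ?(alln k 1%N) // (le_trans ac cb).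
Qed.

Lemma spectrum_eq (R : realType) (N : nat) (X : 'M[R]_N) (s : seq R) :
  is_spectrum X s -> spectrum X = s.
Proof.
move=> Xs; have [] : is_spectrum X (spectrum X) by apply: (xgetPex [::]); exists s.
case: Xs => ss sE st tE; apply: (sorted_eq le_trans le_anti) => //.
by apply: prod_XsubC_eq; rewrite -sE -tE.
Qed.

Lemma Pplus_spectrum (R : realType) (m k : nat) (X : 'M[R]_((m + k).+1))
    (a c b : R) :
  a <= c -> c <= b ->
  char_poly X = ('X - a%:P) ^+ m * ('X - c%:P) ^+ k * ('X - b%:P) ->
  Pplus k.+1 X = c *+ k + b.
Proof.
move=> ac cb Xp.
have sE : spectrum X = nseq m a ++ nseq k c ++ [:: b].
  apply: spectrum_eq; split; first exact: sorted_nseq3.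
  by rewrite Xp !big_cat /= big_seq1 !big_nseq -!Monoid.iteropE mulrA.
(* The index [i = 1] picks the last entry [b]; the indices from 2 to [k.+1] fall exactly on the
   block of [c]. *)
rewrite /Pplus big_ltn // addrC /lambda sE; congr (_ + _).
  rewrite (eq_big_nat _ _ (F2 := fun=> c)); last first.
    move=> i /andP[i1 ik]; rewrite nth_cat size_nseq ifF; last by lia.
    rewrite nth_cat size_nseq ifT; last by lia.
    by rewrite nth_nseq ifT //; lia.
  by rewrite big_const_nat iter_addr_0 subSS subn1.
by rewrite catA nth_cat size_cat !size_nseq subSS subn0 ltnn subnn.
Qed.

Lemma Pplus_scalar_add_const (R : realType) (m k : nat) (a c : R) :
  0 <= c ->
  Pplus k.+1 (a%:M + c *: const_mx 1 : 'M[R]_((m + k).+1)) =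
  a *+ k.+1 + c *+ (m + k).+1.
Proof.
(* The eigenvalue [a], of multiplicity [m + k], is split into [m] copies left out of the sum and [k]
   copies counted. *)
move=> c0; rewrite (@Pplus_spectrum _ m k _ a a (a + c *+ (m + k).+1)) //.
- by rewrite [a *+ k.+1]mulrSr addrA.
- by rewrite lerDl mulrn_wge0.
- by rewrite char_poly_scalar_add_const exprD.
Qed.

Lemma Pplus_block (R : realType) (m k : nat) (a c d : R) :
  a <= d -> d <= a + c *+ m.+1 ->
  Pplus k.+1 (block_mx (a%:M + c *: const_mx 1) 0 0 d%:M : 'M[R]_(m.+1 + k)) =
  d *+ k + (a + c *+ m.+1).
Proof.
set X := block_mx _ _ _ _ => ad db.
suff Xp : char_poly X = ('X - a%:P) ^+ m * ('X - d%:P) ^+ k *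
    ('X - (a + c *+ m.+1)%:P) by exact: (@Pplus_spectrum _ m k X a d).
rewrite /char_poly char_block_diag_mx det_ublock.
rewrite -!/(char_poly _) char_poly_scalar_add_const mulrAC; congr (_ * _ * _).
rewrite char_poly_trig ?scalar_mx_is_trig //.
by under eq_bigr do rewrite mxE eqxx mulr1n; rewrite prodr_const card_ord.
Qed.

(** * Derivatives of products of one-variable functions *)

Section Tensor.
Context {R : realType} {N : nat}.
Implicit Types (g : 'I_N -> R -> R) (x : 'rV[R]_N) (i j : 'I_N).

(** Letting the factors differ keeps this class stable under partial derivatives, so one
    differentiation lemma serves both orders. *)
Definition tensor g x : R := \prod_l g l (x 0 l).

Definition derive_at i g : 'I_N -> R -> R :=
  fun l => if l == i then (g l)^`()%classic else g l.

Lemma is_derive_tensor g x i :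
  derivable (g i) (x 0 i) 1 ->
  is_derive x (basis_vec R i) (tensor g) (tensor (derive_at i g) x).
Proof.
move=> dg; pose C := \prod_(l | l != i) g l (x 0 l).
have dCg : is_derive (x 0 i) (1 : R) (C \*: g i) (C *: (g i)^`()%classic (x 0 i)).
  by rewrite derive1E; apply: is_deriveZ; exact: derivableP.
(* Along [basis_vec R i] only the factor of index [i] varies, so the difference quotients coincide
   with those of a one-variable function. *)
have quotE :
    (fun h : R =>
       h^-1 *: ((tensor g \o shift x) (h *: basis_vec R i) - tensor g x)) =
    (fun h : R =>
       h^-1 *: (((C \*: g i) \o shift (x 0 i)) (h *: 1) - (C \*: g i) (x 0 i))).
  apply/funext => h; congr (_ *: (_ - _)); rewrite /= /tensor (bigD1 i) //= mulrC //.
    congr (_ * _); last by rewrite !mxE !eqxx.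
    apply: eq_bigr => l /negPf li.
    by rewrite !mxE eqxx li /= mulr0 add0r.
have -> : tensor (derive_at i g) x = C *: (g i)^`()%classic (x 0 i).
  rewrite /tensor (bigD1 i) //= mulrC /derive_at eqxx; congr (_ * _).
  by apply: eq_bigr => l /negPf ->.
case: dCg => dC <-; split; first by rewrite /derivable quotE.
by rewrite /derive quotE.
Qed.

Lemma continuous_tensor g x :
  (forall l, {for x 0 l, continuous (g l)}) -> {for x, continuous (tensor g)}.
Proof.
move=> cg; apply: cvg_big => [| |l _]; first exact: mul_continuous.
  exact: (nbhs_filter x).
by apply: continuous_comp; [exact: coord_continuous | exact: cg].
Qed.

Lemma cube_nbhs (r : R) x : cube N r x -> nbhs x (cube N r).
Proof.
move=> xr; exists (fun _ _ => `]- r, r[%classic) => [i j | y yr i].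
  by rewrite ord1; apply: near_in_itvoo; rewrite in_itv /=; exact: xr.
by have := yr 0 i; rewrite /= in_itv.
Qed.

End Tensor.

Lemma near_eq_continuous (T U : topologicalType) (g h : T -> U) (x : T) :
  (\forall y \near x, g y = h y) -> {for x, continuous g} -> {for x, continuous h}.
Proof.
move=> gh cg; rewrite /prop_for /continuous_at -(nbhs_singleton gh).
by apply: cvg_trans cg; exact: near_eq_cvg.
Qed.

(** * Regularity and Hessian of a product with equal factors *)

Section TensorPower.
Context {R : realType} {N : nat} {r : R} {f : R -> R}.
Context (fC2 : C2_itv (- r) r f).
Implicit Types (x : 'rV[R]_N) (i j : 'I_N).

Local Notation phi := (@tensor R N (fun=> f)).

Let derive_phi x j : cube N r x ->
  is_derive x (basis_vec R j) phi (tensor (derive_at j (fun=> f)) x).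
Proof. by move=> xr; apply: is_derive_tensor; case: (fC2 _ (xr j)). Qed.

(** The formula is needed on a neighbourhood in order to differentiate it again and to transfer
    continuity. *)
Let near_derive_phi x j : cube N r x ->
  \forall y \near x, tensor (derive_at j (fun=> f)) y = 'D_(basis_vec R j) phi y.
Proof.
move=> /cube_nbhs; apply: filterS => y yr.
by have [_ ->] := derive_phi y j yr.
Qed.

Let derive2_phi x i j : cube N r x ->
  is_derive x (basis_vec R i) ('D_(basis_vec R j) phi)
    (tensor (derive_at i (derive_at j (fun=> f))) x).
Proof.
move=> xr; apply: near_eq_is_derive (near_derive_phi x j xr) _.
apply: is_derive_tensor; rewrite /derive_at.
by have [df d2f _] := fC2 _ (xr i); case: ifP => _; [exact: d2f | exact: df].
Qed.

Let near_derive2_phi x i j : cube N r x ->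
  \forall y \near x, tensor (derive_at i (derive_at j (fun=> f))) y =
    'D_(basis_vec R i) ('D_(basis_vec R j) phi) y.
Proof.
move=> /cube_nbhs; apply: filterS => y yr.
by have [_ ->] := derive2_phi y i j yr.
Qed.

Lemma C2_tensor : C2_on (cube N r) phi.
Proof.
have cont (t : R) : - r < t < r -> [/\ {for t, continuous f},
    {for t, continuous (f^`()%classic)} &
    {for t, continuous (f^`()%classic^`()%classic)}].
  move=> /fC2[df d2f cf]; split; last exact: cf.
    by apply: differentiable_continuous; apply/derivable1_diffP; exact: df.
  by apply: differentiable_continuous; apply/derivable1_diffP; exact: d2f.
split.
- move=> x xr; apply: continuous_tensor => l.
  by have [cf _ _] := cont _ (xr l); exact: cf.
- by move=> x xr i; have [] := derive_phi x i xr.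
- move=> i x xr; apply: near_eq_continuous (near_derive_phi x i xr) _.
  apply: continuous_tensor => l; rewrite /derive_at.
  by have [cf cf1 _] := cont _ (xr l); case: ifP => _; [exact: cf1 | exact: cf].
- by move=> j x xr i; have [] := derive2_phi x i j xr.
move=> i j x xr; apply: near_eq_continuous (near_derive2_phi x i j xr) _.
apply: continuous_tensor => l; rewrite /derive_at.
have [cf cf1 cf2] := cont _ (xr l).
by case: (l == i); case: (l == j); [exact: cf2 | exact: cf1 | exact: cf1 | exact: cf].
Qed.

Lemma hessian_tensor x : cube N r x -> (forall l, f (x 0 l) != 0) ->
  hessian phi x = \matrix_(i, j) (phi x *
    (if i == j then f^`()%classic^`()%classic (x 0 i) / f (x 0 i)
     else f^`()%classic (x 0 i) / f (x 0 i) * (f^`()%classic (x 0 j) / f (x 0 j)))).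
Proof.
move=> xr fx; apply/matrixP => i j; rewrite !mxE.
have [_ ->] := derive2_phi x i j xr.
rewrite /tensor (bigD1 i) //= [in RHS](bigD1 i) //= /derive_at eqxx.
have [<-|ij] := eqVneq i j.
  rewrite mulrAC mulrCA mulfV // mulr1; congr (_ * _).
  by apply: eq_bigr => l /negPf ->.
rewrite (bigD1 j) /= 1?eq_sym // [in RHS](bigD1 j) /= 1?eq_sym //.
rewrite eq_sym (negPf ij) eqxx.
rewrite (eq_bigr (fun l => f (x 0 l))) => [|l /andP[/negPf -> /negPf ->] //].
by field; rewrite !fx.
Qed.

End TensorPower.

(** * Restriction to the diagonal of the cube *)

Section CubeDiagonal.
Context {R : realType} {N : nat}.
Implicit Types (r t : R).

Lemma continuous_const_mx : continuous (fun t : R => const_mx t : 'rV[R]_N).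
Proof.
move=> t A [P Pt PA].
have : nbhs t (fun s => forall i j, P i j s).
  apply: (@filter_forall _ 'I_1 (fun i s => forall j, P i j s) (nbhs t)) => i.
  apply: (@filter_forall _ 'I_N (fun j => P i j) (nbhs t)) => j.
  by have := Pt i j; rewrite mxE.
by apply: filterS => s Ps; apply: PA => i j; rewrite mxE.
Qed.

Lemma cube_const_mx r t : - r < t < r -> cube N r (const_mx t).
Proof. by move=> tr i; rewrite mxE. Qed.

Lemma closure_cube_const_mx r t : 0 < r -> - r <= t <= r ->
  closure (cube N r) (const_mx t).
Proof.
move=> r0 /andP[rt tr] B /continuous_const_mx Bt.
(* Shrinking [t] by the factor [1 - e] with small [e > 0] moves the point into the open cube. *)
have ct : (t * (1 - e)) @[e --> 0^'+] --> t.
  rewrite -[X in _ --> X](mulr1 t) -[X in _ --> t * X](subr0 1).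
  apply: cvg_at_right_filter; apply: cvgMr; apply: cvgB; first exact: cvg_cst.
  exact: cvg_id.
pose F := at_right (0 : R).
have Be : F (fun e => B (const_mx (t * (1 - e)))) := ct _ Bt.
have F0 : F (fun e => 0 < e) := nbhs_right_gt 0.
have F1 : F (fun e => e < 1) := nbhs_right_lt ltr01.
have [e [{}Be [/= e0 e1]]] := filter_ex (filterI Be (filterI F0 F1)).
exists (const_mx (t * (1 - e))); split=> //; apply: cube_const_mx.
by apply/andP; split; nra.
Qed.

Lemma boundary_cube_const_mx r t : (0 < N)%N -> 0 < r -> `|t| = r ->
  boundary (cube N r) (const_mx t).
Proof.
move=> N0 r0 tr; split; first by apply: closure_cube_const_mx; rewrite // -ler_norml tr.
move=> /interior_subset /(_ (Ordinal N0)); rewrite mxE.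
by rewrite -ltr_norml tr ltxx.
Qed.

Lemma within_continuous_diagonal r (u : 'rV[R]_N -> R) : 0 < r ->
  {within closure (cube N r), continuous u} ->
  {within `[- r, r], continuous (fun t => u (const_mx t))}.
Proof.
move=> r0 /subspace_continuousP cu; apply/subspace_continuousP => t /= tr.
have tc : closure (cube N r) (const_mx t).
  by apply: closure_cube_const_mx => //; rewrite in_itv in tr.
move=> W /(cu _ tc) /continuous_const_mx Ws.
suff : nbhs t (fun s => s \in `[- r, r] -> W (u (const_mx s))) by [].
move: Ws; apply: (@filterS _ (nbhs t)) => s sW; rewrite in_itv /= => sr; apply: sW.
exact: closure_cube_const_mx.
Qed.

End CubeDiagonal.

(** Near [x] the difference [u - phi] is identically zero, so [phi] is a test function at [x] from
    above and from below. *)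
Lemma viscosity_solution_classical (R : realType) (N k : nat) (mu : R)
    (U : set 'rV[R]_N) (u phi : 'rV[R]_N -> R) (x : 'rV[R]_N) :
  viscosity_solution k mu U u -> C2_on U phi -> (forall y, U y -> u y = phi y) ->
  U x -> nbhs x U -> Pplus k (hessian phi x) + mu * phi x = 0.
Proof.
move=> [sub sup] phiC2 uphi Ux nU; rewrite -uphi //.
have eq0 y : U y -> u y - phi y = 0 by move=> /uphi ->; rewrite subrr.
apply/eqP; rewrite eq_le; apply/andP; split.
  by apply: sup => //; apply: filterS nU => y Uy; rewrite !eq0.
by apply: sub => //; apply: filterS nU => y Uy; rewrite !eq0.
Qed.

Definition log_derive1 (R : realType) (f : R -> R) (t : R) : R :=
  f^`()%classic t / f t.

(* Where [f] is nonzero and twice derivable, this is the derivative of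
   [log_derive1 f]. *)
Definition log_derive2 (R : realType) (f : R -> R) (t : R) : R :=
  f^`()%classic^`()%classic t / f t - log_derive1 R f t ^+ 2.

(** * The Hessian at points with one or two distinct coordinate values *)

Section HessianTensorPower.
Context {R : realType} {r : R} {f : R -> R}.
Context (fC2 : C2_itv (- r) r f).

Local Notation p := (log_derive1 R f).
Local Notation a := (log_derive2 R f).

Lemma hessian_tensor_diagonal (N : nat) (t : R) : - r < t < r -> f t != 0 ->
  let phi := @tensor R N (fun=> f) in let x := const_mx t in
  hessian phi x = (phi x * a t)%:M + (phi x * p t ^+ 2) *: const_mx 1.
Proof.
move=> tr ft phi x; rewrite (hessian_tensor fC2); last 2 first.
- exact: cube_const_mx.
- by move=> l; rewrite mxE.
apply/matrixP => i j; rewrite !mxE -/phi -/(p t) /log_derive2; case: eqP => _ /=.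
  by rewrite mulr1n; ring.
by rewrite mulr0n; ring.
Qed.

(** As [p s = 0], every off-diagonal entry involving a coordinate [s] vanishes, which decouples the
    two blocks and makes the second one scalar. *)
Lemma hessian_tensor_row_mx (m k : nat) (t s : R) :
  - r < t < r -> - r < s < r -> f t != 0 -> f s != 0 -> f^`()%classic s = 0 ->
  let phi := @tensor R (m + k) (fun=> f) in
  let x := row_mx (const_mx t) (const_mx s) in
  hessian phi x = block_mx ((phi x * a t)%:M + (phi x * p t ^+ 2) *: const_mx 1)
                           0 0 (phi x * a s)%:M.
Proof.
move=> tr sr ft fs ds phi x.
have xl i : x 0 (lshift k i) = t by rewrite row_mxEl mxE.
have xr i : x 0 (rshift m i) = s by rewrite row_mxEr mxE.
rewrite (hessian_tensor fC2); last 2 first.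
- by move=> l; rewrite -(fintype.splitK l); case: (fintype.split l) => i; rewrite ?xl ?xr.
- by move=> l; rewrite -(fintype.splitK l); case: (fintype.split l) => i; rewrite ?xl ?xr.
have ps : p s = 0 by rewrite /log_derive1 ds mul0r.
apply/matrixP => i j; rewrite -(fintype.splitK i) -(fintype.splitK j) mxE -/phi.
case: (fintype.split i) => {}i; case: (fintype.split j) => {}j /=;
  rewrite ?(block_mxEul, block_mxEur, block_mxEdl, block_mxEdr) ?xl ?xr
    ?eq_lshift ?eq_rshift ?eq_lrshift ?eq_rlshift ![in RHS]mxE -/(p t) -/(p s).
- by rewrite /log_derive2; case: eqP => _; rewrite ?mulr1n ?mulr0n; ring.
- by rewrite ps mulr0 mulr0.
- by rewrite ps mul0r mulr0.
- by rewrite /log_derive2 ps; case: eqP => _; rewrite ?mulr1n ?mulr0n; ring.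
Qed.

End HessianTensorPower.

(** * The contradiction between the diagonal point and the mixed point *)

Theorem theorem3 (R : realType) (k N : nat) (r mu : R) (u : 'rV[R]_N -> R) :
  (2 <= k <= N - 1)%N ->
  0 < r ->
  {within closure (cube N r), continuous u} ->
  viscosity_solution k mu (cube N r) u ->
  (forall x, cube N r x -> 0 < u x) ->
  (forall x, boundary (cube N r) x -> u x = 0) ->
  ~ exists f : R -> R, C2_itv (- r) r f /\
      forall x, cube N r x -> u x = \prod_(i < N) f (x 0 i).
Proof.
move=> kN r0 cu visc upos ubd [f [fC2 uf]].
(* Here [m = N - k] and [l = k - 1]; the bounds on [k] make both positive, and [m.+1 + l] is the
   block shape of the mixed point. *)
have [m [l [m0 l0 kE NE]]] :
    exists m l, [/\ (0 < m)%N, (0 < l)%N, k = l.+1 & N = (m.+1 + l)%N].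
  by exists (N - k)%N, k.-1; split; lia.
subst k N; set N := (m.+1 + l)%N in u cu visc upos ubd uf *.
pose phi := @tensor R N (fun=> f).
have pde x : cube N r x -> Pplus l.+1 (hessian phi x) + mu * phi x = 0.
  move=> xr; apply: viscosity_solution_classical visc _ uf xr (cube_nbhs _ _ xr).
  exact: C2_tensor.
have phi0 x : cube N r x -> 0 < phi x by move=> xr; rewrite -[phi x]uf ?upos.
have uN t : - r < t < r -> u (const_mx t) = f t ^+ N.
  move=> tr; rewrite uf; last exact: cube_const_mx.
  by under eq_bigr do rewrite mxE; rewrite prodr_const card_ord.
(* Only [f t ^+ N] is known to be positive, so the sign of [f] stays open. *)
have f0 t : - r < t < r -> f t != 0.
  move=> tr; have := upos _ (cube_const_mx _ _ tr).
  by rewrite uN //; apply: contraTneq => ->; rewrite expr0n ltxx.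
pose h t := u (const_mx t).
have hend t : `|t| = r -> h t = 0.
  by move=> tr; apply: ubd; exact: boundary_cube_const_mx.
have ch : {within `[- r, r], continuous h} by exact: within_continuous_diagonal.
pose dh t := (N%:R * f t ^+ N.-1) * f^`()%classic t.
have dhP t : t \in `]- r, r[ -> is_derive t 1 h (dh t).
  move=> tr; apply: (@near_eq_is_derive _ _ _ (f ^+ N)).
    apply: filterS (near_in_itvoo tr) => s sr.
    by rewrite /h uN ?exprfctE.
  rewrite in_itv in tr; have [df _ _] := fC2 _ tr.
  by apply: is_deriveX; rewrite derive1E; exact: derivableP.
(* Rolle: [h] vanishes at both ends, and in [dh s = 0] the factor [f s ^+ N.-1] is nonzero. *)
have [s sr ds] : exists2 s, - r < s < r & f^`()%classic s = 0.
  have rr : - r < r by lra.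
  have [s sr] := MVT rr dhP ch; rewrite in_itv /= in sr.
  rewrite !hend ?normrN ?gtr0_norm // subrr => /esym/eqP.
  rewrite !mulf_eq0 pnatr_eq0 expf_eq0 (negPf (f0 _ sr)) andbF /=.
  by case/orP => [/eqP|]; [exists s | lra].
(* The mean value theorem on [[0, r]]: [h] falls from a positive value to 0, so [dh] is nonzero
   somewhere. *)
have [t tr dt] : exists2 t, - r < t < r & f^`()%classic t != 0.
  have sub0 : `[0, r]%classic `<=` `[- r, r]%classic.
    by move=> z /=; rewrite !in_itv /=; lra.
  have dhP0 z : z \in `]0, r[ -> is_derive z 1 h (dh z).
    by rewrite in_itv /= => zr; apply: dhP; rewrite in_itv /=; lra.
  have [t] := MVT r0 dhP0 (continuous_subspaceW sub0 ch); rewrite in_itv /= => tr.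
  rewrite (hend r) ?gtr0_norm // sub0r subr0 => ht; exists t; first by lra.
  have h0 : 0 < h 0 by apply: upos; apply: cube_const_mx; lra.
  apply: contraTneq h0 => dt; move: ht; rewrite /dh dt mulr0 mul0r; lra.
pose p := log_derive1 R f.
pose a := log_derive2 R f.
(* The equation on the diagonal, divided by [phi > 0]. *)
have ode z : - r < z < r -> a z * l.+1%:R + p z ^+ 2 * N%:R = - mu.
  move=> zr; have xr := cube_const_mx (N := N) _ _ zr; have U0 := phi0 _ xr.
  have := pde _ xr; rewrite (hessian_tensor_diagonal fC2 _ _ zr (f0 _ zr)).
  rewrite (Pplus_scalar_add_const _ m); last exact: mulr_ge0 (ltW U0) (sqr_ge0 _).
  rewrite -/phi -/p -/a.
  set U := phi _ in U0 *.
  rewrite -(mulr_natr _ l.+1) -(mulr_natr _ (m + l).+1) => eq0.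
  apply: (mulfI (lt0r_neq0 U0)); rewrite /N addSn; lra.
have ps : p s = 0 by rewrite /p /log_derive1 ds mul0r.
have pt : 0 < p t ^+ 2 by rewrite exprn_even_gt0 // mulf_neq0 ?invr_neq0 ?f0.
have os := ode s sr; have ot := ode t tr; rewrite ps expr0n mul0r addr0 in os.
have lR : 0 < l%:R :> R by rewrite ltr0n.
have mR : 0 < m%:R :> R by rewrite ltr0n.
have NR : N%:R = m%:R + 1 + l%:R :> R by rewrite /N natrD -natr1.
have l1R : l.+1%:R = l%:R + 1 :> R by rewrite -natr1.
rewrite NR l1R in os ot.
(* Difference of the equations at [s] and [t]; [gap] then uses
   [(m + 1) * (l + 1) - (m + 1 + l) = m * l]. *)
have as_at : (a s - a t) * (l%:R + 1) = p t ^+ 2 * (m%:R + 1 + l%:R) by lra.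
have gap : (a t + p t ^+ 2 * (m%:R + 1) - a s) * (l%:R + 1) =
    p t ^+ 2 * (m%:R * l%:R) by lra.
have l1_gt0 : 0 < l%:R + 1 :> R by lra.
have gap0 : 0 < a t + p t ^+ 2 * (m%:R + 1) - a s.
  rewrite -(pmulr_lgt0 _ l1_gt0) gap; apply: mulr_gt0 => //; exact: mulr_gt0.
have le_ts : a t <= a s.
  rewrite -subr_ge0 -(pmulr_lge0 _ l1_gt0) as_at.
  by apply: mulr_ge0; [exact: ltW | lra].
pose x : 'rV[R]_N := row_mx (const_mx t) (const_mx s).
have xr : cube N r x.
  move=> i; rewrite -(fintype.splitK i); case: (fintype.split i) => j /=.
    by rewrite row_mxEl mxE.
  by rewrite row_mxEr mxE.
have U0 := phi0 _ xr; have := pde _ xr.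
rewrite (hessian_tensor_row_mx fC2 _ _ _ _ tr sr (f0 _ tr) (f0 _ sr) ds).
rewrite -/phi -/x -/p -/a; move: (phi x) U0 => U U0; clearbody p a.
have m1E (y : R) : y *+ m.+1 = y * (m%:R + 1) by rewrite -[LHS]mulr_natr -natr1.
(* The eigenvalue ordering is [le_ts] and [gap0], scaled by [U > 0]. *)
rewrite Pplus_block; last 2 first.
- by rewrite ler_pM2l.
- by rewrite m1E -mulrA -mulrDr ler_pM2l //; lra.
rewrite m1E -(mulr_natr _ l).
(* Compared with [os], that is [a s * (l + 1) = - mu], this forces the quantity in [gap0] to be
   zero. *)
move=> eq0; have : a s * l%:R + (a t + p t ^+ 2 * (m%:R + 1)) = - mu.
  by apply: (mulfI (lt0r_neq0 U0)); lra.
lra.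
Qed.
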